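(* Let $d\ge 1$ and let $p$ be a form of degree $2d$ in $n$ variables with minimum $p_{\min}$ and maximum $p_{\max}$ on the unit sphere, so that $p_{\min}\|x\|^{2d}\le p(x)\le p_{\max}\|x\|^{2d}$ for all $x\in\mathbb{R}^n$, and suppose $p_{\min}<p_{\max}$ (so that $\mathrm{gap}(p)$ is defined). If $\mathrm{gap}(p)>d$, then the form $$p(x)-\left[d\,p_{\min}-(d-1)\,p_{\max}\right]\|x\|^{2d}$$ is convex but is not a sum of squares.
   Context: A form is a homogeneous polynomial with real coefficients; $\|x\|$ is the Euclidean norm on $\mathbb{R}^n$, and $\|x\|^{2d}=(x_1^2+\cdots+x_n^2)^d$. A form is a sum of squares if it is a finite sum of squares of real polynomials. A form is convex if it is a convex function on $\mathbb{R}^n$. For a form $p$ of degree $2d$ in $n$ variables, $p_{\min}=\min_{\|x\|=1}p(x)$, $p_{\max}=\max_{\|x\|=1}p(x)$, $$p_{\min}^{\mathrm{sos}}=\max\{\gamma\in\mathbb{R} : p(x)-\gamma\|x\|^{2d}\text{ is a sum of squares}\},$$ and, when $p_{\max}>p_{\min}$, $$\mathrm{gap}(p)=\frac{p_{\max}-p_{\min}^{\mathrm{sos}}}{p_{\max}-p_{\min}}.$$ *)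

(* Defs.v *)
From HB Require Import structures.
From mathcomp Require Import all_boot all_order all_algebra.
From mathcomp Require Import classical_sets reals.
From mathcomp Require Import mpoly.
From mathcomp Require Import convex.

Set Implicit Arguments.
Unset Strict Implicit.
Unset Printing Implicit Defensive.

Import Order.TTheory GRing.Theory Num.Theory.

Local Open Scope classical_set_scope.
Local Open Scope ring_scope.

(* Points of R^n are row vectors; the normed-module structure of
   'rV[R]_n uses the max norm, hence the explicit Euclidean norm here. *)
Definition enorm (R : realType) (n : nat) (x : 'rV[R]_n) : R :=
  Num.sqrt (\sum_(i < n) x ord0 i ^+ 2).

Definition unit_sphere (R : realType) (n : nat) : set 'rV[R]_n :=
  [set x | enorm x = 1].

Definition polyfun (R : realType) (n : nat) (p : {mpoly R[n]}) : 'rV[R]_n -> R :=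
  fun x => p.@[x ord0].

Definition norm_form (R : realType) (n d : nat) : {mpoly R[n]} :=
  (\sum_(i < n) 'X_i ^+ 2) ^+ d.

Definition is_sos (R : realType) (n : nat) (p : {mpoly R[n]}) : Prop :=
  exists qs : seq {mpoly R[n]}, p = \sum_(q <- qs) q ^+ 2.

Definition is_convex (R : realType) (n : nat) (p : {mpoly R[n]}) : Prop :=
  @convex_function R 'rV[R]_n [set: 'rV[R]_n] (polyfun p).

(* The extrema below are written with the total operators inf and sup. By
   compactness of the sphere and closedness of the cone of sums of squares of
   bounded degree, they are attained when 0 < n and p is a form of degree 2d;
   pmin_minE, pmax_maxE and pmin_sos_maxE identify them with the minimum,
   respectively maximum. For n = 0 the sphere is empty and pmin p = pmax p = 0. *)
Definition pmin (R : realType) (n : nat) (p : {mpoly R[n]}) : R :=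
  inf [set polyfun p x | x in @unit_sphere R n].

Definition pmax (R : realType) (n : nat) (p : {mpoly R[n]}) : R :=
  sup [set polyfun p x | x in @unit_sphere R n].

Definition sos_lower_bounds (R : realType) (n d : nat) (p : {mpoly R[n]}) : set R :=
  [set g : R | is_sos (p - g *: norm_form R n d)].

Definition pmin_sos (R : realType) (n d : nat) (p : {mpoly R[n]}) : R :=
  sup (sos_lower_bounds d p).

(* Meaningful only when pmin p < pmax p. *)
Definition gap (R : realType) (n d : nat) (p : {mpoly R[n]}) : R :=
  (pmax p - pmin_sos d p) / (pmax p - pmin p).

Lemma enorm_norm_form (R : realType) (n d : nat) (x : 'rV[R]_n) :
  polyfun (norm_form R n d) x = enorm x ^+ (2 * d).
Proof.
rewrite /polyfun /norm_form rmorphXn /= exprM sqr_sqrtr; last first.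
  by apply: sumr_ge0 => i _; exact: sqr_ge0.
congr (_ ^+ d); rewrite rmorph_sum /=; apply: eq_bigr => i _.
by rewrite rmorphXn /= mevalXU.
Qed.

Lemma sup_maxE (R : realType) (A : set R) (m : R) : A m -> ubound A m -> sup A = m.
Proof.
move=> Am ubm; apply/eqP; rewrite eq_le; apply/andP; split.
  by apply: ge_sup => //; exists m.
by apply: ub_le_sup => //; exists m.
Qed.

Lemma inf_minE (R : realType) (A : set R) (m : R) : A m -> lbound A m -> inf A = m.
Proof.
move=> Am lbm; apply/eqP; rewrite eq_le; apply/andP; split.
  by apply: ge_inf => //; exists m.
by apply: lb_le_inf => //; exists m.
Qed.

Lemma pmin_minE (R : realType) (n : nat) (p : {mpoly R[n]}) (x0 : 'rV[R]_n) :
  enorm x0 = 1 -> (forall x, enorm x = 1 -> polyfun p x0 <= polyfun p x) ->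
  pmin p = polyfun p x0.
Proof.
move=> x0S h; apply: inf_minE; first by exists x0.
by move=> _ [x xS <-]; exact: h.
Qed.

Lemma pmax_maxE (R : realType) (n : nat) (p : {mpoly R[n]}) (x0 : 'rV[R]_n) :
  enorm x0 = 1 -> (forall x, enorm x = 1 -> polyfun p x <= polyfun p x0) ->
  pmax p = polyfun p x0.
Proof.
move=> x0S h; apply: sup_maxE; first by exists x0.
by move=> _ [x xS <-]; exact: h.
Qed.

Lemma pmin_sos_maxE (R : realType) (n d : nat) (p : {mpoly R[n]}) (g : R) :
  sos_lower_bounds d p g -> ubound (sos_lower_bounds d p) g -> pmin_sos d p = g.
Proof. exact: sup_maxE. Qed.

(* Main.v *)
(* Idea. If q were a sum of squares, the constant d pmin - (d-1) pmax would be
   at most pmin_sos, contrary to gap > d.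
   For convexity put T = p - (pmin + pmax)/2 |x|^(2d) and M = (pmax - pmin)/2, so
   that |T| <= M on the sphere and q = T + (2d-1) M |x|^(2d). For unit vectors x
   and u, Banach's inequality on symmetric multilinear forms bounds D_u^2 T(x)
   by 2d(2d-1) M, while D_u^2 |x|^(2d) >= 2d on the sphere; hence D_u^2 q >= 0.
   The instance of Banach's inequality is proved for F(t) = T(x + t u) with x, u
   orthonormal. If |F''(t0)| is too large, then some D = Re(z (1 + i t)^(2d)) - F
   with |z| > M has D'(t0) = D''(t0) = 0. But cos^(2d) D(tan) is a cosine of
   amplitude |z| minus a term bounded by M, so it changes sign 2d times over an
   angle pi, and D splits with simple real roots; then D'^2 - D D'' > 0 on R. *)
Require Import Defs.
From mathcomp Require Import all_boot all_order all_algebra.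
From mathcomp Require Import classical_sets reals.
From mathcomp Require Import mpoly.
From mathcomp Require Import boolp interval_inference polyrcf.
From mathcomp Require Import topology normedtype realfun trigo.
From mathcomp Require Import ring lra.

Set Implicit Arguments.
Unset Strict Implicit.
Unset Printing Implicit Defensive.

Import Order.TTheory GRing.Theory Num.Theory.
Import numFieldNormedType.Exports.

Local Open Scope classical_set_scope.
Local Open Scope ring_scope.

(* The real and imaginary parts of (1 + i X)^k. *)
Fixpoint harm (R : nzRingType) (k : nat) : {poly R} * {poly R} :=
  if k is l.+1 then
    ((harm R l).1 - (harm R l).2 * 'X, (harm R l).2 + (harm R l).1 * 'X)
  else (1, 0).

(* The value at (cos a, sin a) of the binary form of degree k that dehomogenizes
   to F: it is cos^k a F(tan a), extended continuously to cos a = 0. *)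
Definition homogenization (R : realType) (k : nat) (F : {poly R}) (a : R) : R :=
  \sum_(i < k.+1) F`_i * (sin a ^+ i * cos a ^+ (k - i)).

(** * Laguerre's inequality for simple real roots *)

(** Adjoining a factor X - r to Q turns Q'^2 - Q Q'' into Q^2 + (t - r)^2 (Q'^2 - Q Q''). For
    distinct roots the two summands never vanish together, since Q(t) = 0 forces t <> r. *)
Lemma prod_XsubC_laguerre (R : realFieldType) (rs : seq R) (t : R) :
  (0 < size rs)%N -> uniq rs ->
  let P := \prod_(r <- rs) ('X - r%:P) in
  0 < P^`().[t] ^+ 2 - P.[t] * P^`()^`().[t].
Proof.
elim: rs => //= r rs IH _ /andP[rNrs uniq_rs].
rewrite big_cons; set Q := \prod_(r <- rs) _ in IH *.
have -> : (('X - r%:P) * Q)^`() = Q + ('X - r%:P) * Q^`().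
  by rewrite derivM derivXsubC mul1r.
have -> : (Q + ('X - r%:P) * Q^`())^`()
        = Q^`() *+ 2 + ('X - r%:P) * Q^`()^`().
  by rewrite derivD derivM derivXsubC mul1r addrA -mulr2n.
rewrite !hornerE.
have -> : (Q.[t] + (t - r) * Q^`().[t]) ^+ 2
        - (t - r) * Q.[t] * (Q^`().[t] + Q^`().[t] + (t - r) * Q^`()^`().[t])
        = Q.[t] ^+ 2 + (t - r) ^+ 2 * (Q^`().[t] ^+ 2 - Q.[t] * Q^`()^`().[t]).
  by ring.
have [rs0|rs_gt0] := posnP (size rs).
  have -> : Q = 1 by rewrite /Q (size0nil rs0) big_nil.
  by rewrite -polyC1 derivC deriv0 !hornerE /=; lra.
have {IH} := IH rs_gt0 uniq_rs; rewrite /= => IH.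
have [Qt0|Qt0] := eqVneq Q.[t] 0; last first.
  by rewrite ltr_pwDl ?exprn_even_gt0 // mulr_ge0 ?sqr_ge0 // ltW.
have tr : t - r != 0.
  apply: contra rNrs; rewrite subr_eq0 => /eqP <-.
  by rewrite -root_prod_XsubC rootE; apply/eqP.
by rewrite Qt0 expr0n add0r mulr_gt0 ?exprn_even_gt0 // -[X in X * _]Qt0.
Qed.

(** * The powers of 1 + i X *)

Lemma size_harm (R : nzRingType) (k : nat) :
  (size (harm R k).1 <= k.+1)%N /\ (size (harm R k).2 <= k.+1)%N.
Proof.
elim: k => [|k [IHc IHs]] /=; first by rewrite size_poly1 size_poly0.
have szX (P : {poly R}) : (size P <= k.+1)%N -> (size (P * 'X)%R <= k.+2)%N.
  move=> szP; apply: leq_trans (size_polyMleq _ _) _.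
  by rewrite size_polyX addn2.
split; first by rewrite (leq_trans (size_polyD _ _)) // size_polyN geq_max szX // leqW.
by rewrite (leq_trans (size_polyD _ _)) // geq_max szX // leqW.
Qed.

(** These are the real and imaginary parts of the rule that (1 + i X)^(k+1) has derivative (k + 1) i
    (1 + i X)^k. *)
Lemma deriv_harm (R : comNzRingType) (k : nat) :
  (harm R k.+1).1^`() = - ((harm R k).2 *+ k.+1) /\
  (harm R k.+1).2^`() = (harm R k).1 *+ k.+1.
Proof.
elim: k => [|k [IHc IHs]].
  by rewrite /= mul0r mul1r subr0 add0r derivX -polyC1 derivC oppr0.
have IH1 : (harm R k.+2).1^`() = (harm R k.+1).1^`()
    - ((harm R k.+1).2^`() * 'X + (harm R k.+1).2).
  by rewrite derivB derivM derivX mulr1.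
have IH2 : (harm R k.+2).2^`() = (harm R k.+1).2^`()
    + ((harm R k.+1).1^`() * 'X + (harm R k.+1).1).
  by rewrite derivD derivM derivX mulr1.
rewrite IH1 IH2 IHc IHs; split; rewrite [in RHS]mulrSr /=; ring.
Qed.

(** The squared modulus of 1 + i t is 1 + t^2, and moduli multiply. *)
Lemma sqr_harm (R : comNzRingType) (k : nat) (t : R) :
  (harm R k).1.[t] ^+ 2 + (harm R k).2.[t] ^+ 2 = (1 + t ^+ 2) ^+ k.
Proof.
elim: k => [|k IH] /=; first by rewrite !hornerE /= expr0; ring.
by rewrite [RHS]exprS -IH !hornerE; ring.
Qed.

(** * Homogenization on the circle *)

Lemma homogenizationB (R : realType) k (F G : {poly R}) a :
  homogenization k (F - G) a = homogenization k F a - homogenization k G a.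
Proof.
rewrite /homogenization -sumrB; apply: eq_bigr => i _.
by rewrite coefB mulrBl.
Qed.

Lemma homogenizationD (R : realType) k (F G : {poly R}) a :
  homogenization k (F + G) a = homogenization k F a + homogenization k G a.
Proof.
rewrite /homogenization -big_split; apply: eq_bigr => i _.
by rewrite coefD mulrDl.
Qed.

Lemma homogenizationZ (R : realType) k c (F : {poly R}) a :
  homogenization k (c *: F) a = c * homogenization k F a.
Proof.
rewrite /homogenization mulr_sumr; apply: eq_bigr => i _.
by rewrite coefZ mulrA.
Qed.

Lemma homogenizationS (R : realType) k (F : {poly R}) a :
  (size F <= k.+1)%N -> homogenization k.+1 F a = cos a * homogenization k F a.
Proof.
move=> szF; rewrite /homogenization big_ord_recr /= nth_default // mul0r addr0.
rewrite mulr_sumr; apply: eq_bigr => i _; rewrite /= subSn -1?ltnS // exprS; ring.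
Qed.

Lemma homogenizationMX (R : realType) k (F : {poly R}) a :
  homogenization k.+1 (F * 'X) a = sin a * homogenization k F a.
Proof.
rewrite /homogenization big_ord_recl /= coefMX /= mul0r add0r.
rewrite mulr_sumr; apply: eq_bigr => i _.
by rewrite coefMX /= /bump /= add1n subSS exprS; ring.
Qed.

Lemma homogenization_tan (R : realType) k (F : {poly R}) a :
  (size F <= k.+1)%N -> cos a != 0 ->
  homogenization k F a = F.[tan a] * cos a ^+ k.
Proof.
move=> szF ca; rewrite (horner_coef_wide _ szF) mulr_suml /homogenization.
apply: eq_bigr => i _; rewrite -mulrA; congr (_ * _).
have ik : (i <= k)%N by rewrite -ltnS.
have -> : cos a ^+ k = cos a ^+ i * cos a ^+ (k - i) by rewrite -exprD subnKC.
by rewrite /tan expr_div_n mulrA divfK // expf_neq0.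
Qed.

(** The angles with cos a = 0 are the point at infinity of the projective line, where only the
    coefficient of X^k survives. *)
Lemma homogenization_infty (R : realType) k (F : {poly R}) a :
  cos a = 0 -> homogenization k F a = F`_k * sin a ^+ k.
Proof.
move=> ca; rewrite /homogenization big_ord_recr /= subnn mulr1 big1 ?add0r //.
by move=> i _; rewrite ca expr0n subn_eq0 leqNgt ltn_ord /= !mulr0.
Qed.

(** De Moivre's formula: cos a (1 + i tan a) = exp(i a), raised to the power k. *)
Lemma homogenization_harm (R : realType) k (a : R) :
  homogenization k (harm R k).1 a = cos (k%:R * a) /\
  homogenization k (harm R k).2 a = sin (k%:R * a).
Proof.
elim: k => [|k [IHc IHs]].
  rewrite !mul0r cos0 sin0 /homogenization !big_ord_recl !big_ord0 /=.
  by rewrite coef1 coef0 !expr0 /=; split; ring.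
have [szc szs] := size_harm R k.
rewrite /= homogenizationB homogenizationD !homogenizationMX.
rewrite !homogenizationS // IHc IHs -natr1 mulrDl mul1r cosD sinD.
by split; ring.
Qed.

Lemma continuous_homogenization (R : realType) k (F : {poly R}) :
  continuous (homogenization k F).
Proof.
apply: continuous_big => [|i _ a]; first exact: add_continuous.
have sincos_cvg n (g : R -> R) : continuous g -> g x ^+ n @[x --> a] --> g a ^+ n.
  move=> cg; apply: (@continuous_comp _ _ _ g (fun y => y ^+ n)); first exact: cg.
  exact: exprn_continuous.
apply: cvgM; first exact: cvg_cst.
apply: cvgM; apply: sincos_cvg; [exact: continuous_sin|exact: continuous_cos].
Qed.

(** * Zeros of a perturbed cosine and real-rootedness *)

Lemma polar_coordinates (R : realType) (x y : R) :
  exists psi, x = Num.sqrt (x ^+ 2 + y ^+ 2) * cos psi /\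
              y = Num.sqrt (x ^+ 2 + y ^+ 2) * sin psi.
Proof.
set r := Num.sqrt _.
have r2 : r ^+ 2 = x ^+ 2 + y ^+ 2 by rewrite sqr_sqrtr // addr_ge0 ?sqr_ge0.
have [r0|r0] := eqVneq r 0.
  move/eqP: r2; rewrite r0 expr0n /= eq_sym paddr_eq0 ?sqr_ge0 // !sqrf_eq0.
  by move=> /andP[/eqP -> /eqP ->]; exists 0; rewrite !mul0r.
have r_gt0 : 0 < r by rewrite lt_neqAle eq_sym r0 sqrtr_ge0.
have xr : -1 <= x / r <= 1.
  rewrite -ler_norml normrM normfV (gtr0_norm r_gt0) ler_pdivrMr // mul1r.
  by rewrite -(gtr0_norm r_gt0) -ler_sqr ?nnegrE // !real_normK ?num_real // r2 lerDl sqr_ge0.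
have cosr : x = r * cos (acos (x / r)) by rewrite acosK // mulrC divfK.
have sinr : `|y| = r * sin (acos (x / r)).
  rewrite sin_acos // -sqrtr_sqr {1}/r -sqrtrM ?addr_ge0 ?sqr_ge0 //.
  congr Num.sqrt; rewrite expr_div_n r2; field.
  by rewrite -r2 expf_neq0.
(* [acos] only gives angles with nonnegative sine, so the sign of y selects the angle or its
   opposite. *)
have [y0|y0] := leP 0 y.
  by exists (acos (x / r)); rewrite -sinr ger0_norm.
exists (- acos (x / r)); rewrite cosN sinN mulrN -sinr ltr0_norm ?opprK //.
Qed.

Lemma cos_natpi (R : realType) (j : nat) : cos (j%:R * pi) = (-1) ^+ j :> R.
Proof.
by elim: j => [|j IH]; rewrite ?mul0r ?cos0 // -natr1 mulrDl mul1r cosDpi IH exprS mulN1r.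
Qed.

(** At the nodes (j pi - psi) / k the cosine equals (-1)^j, and M < rho lets f keep that sign. The
    intermediate value theorem then gives a zero strictly between consecutive nodes. *)
Lemma perturbed_cos_roots (R : realType) (f : R -> R) (k : nat) (rho psi M : R) :
  (0 < k)%N -> M < rho -> continuous f ->
  (forall a, `|f a - rho * cos (k%:R * a + psi)| <= M) ->
  exists xi : 'I_k -> R, forall j,
    f (xi j) = 0 /\
    (j%:R * pi - psi) / k%:R < xi j < (j.+1%:R * pi - psi) / k%:R.
Proof.
move=> k_gt0 Mrho cf fM.
have kR_gt0 : 0 < k%:R :> R by rewrite ltr0n.
pose node (j : nat) : R := (j%:R * pi - psi) / k%:R.
have f_node j : if odd j then f (node j) < 0 else 0 < f (node j).
  have := fM (node j); rewrite [X in X + psi]mulrC divfK ?gt_eqF // subrK cos_natpi.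
  rewrite -signr_odd ler_norml => /andP[].
  by case: (odd j); rewrite /= ?expr0 ?expr1; lra.
have root_between (j : 'I_k) : exists x, f x = 0 /\ node j < x < node j.+1.
  have node_le : node j <= node j.+1.
    by rewrite ler_pM2r ?invr_gt0 // lerD2r ler_pM2r ?pi_gt0 // ler_nat.
  have [|x xj fx] := IVT (v := 0) node_le (continuous_subspaceT cf).
    rewrite ge_min le_max; have := f_node j; have := f_node j.+1 => /=.
    by case: (odd j) => /= /ltW -> /ltW ->; rewrite ?orbT.
  exists x; split=> //; move: xj; rewrite in_itv /= !le_eqVlt.
  have neq i : node i == x = false.
    apply/eqP => xE; have := f_node i; rewrite xE fx ltxx.
    by case: odd.
  by rewrite neq [x == _]eq_sym neq.
by have [xi xiP] := fin_all_exists root_between; exists xi.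
Qed.

(** The k zeros differ pairwise by less than pi, so they are distinct points of the projective line.
    Those with nonzero cosine have distinct tangents, which are roots of D. At most one zero lies at
    infinity, and it lowers the degree by one, so the finite roots exhaust the degree. *)
Lemma split_of_perturbed_cos (R : realType) (D : {poly R}) (k : nat) (rho psi M : R) :
  (1 < k)%N -> (size D <= k.+1)%N -> M < rho ->
  (forall a, `|homogenization k D a - rho * cos (k%:R * a + psi)| <= M) ->
  exists rs : seq R, [/\ (0 < size rs)%N, uniq rs, lead_coef D != 0
    & D = lead_coef D *: \prod_(r <- rs) ('X - r%:P)].
Proof.
move=> k_gt1 szD Mrho fM; have k_gt0 := ltnW k_gt1.
have kR_gt0 : 0 < k%:R :> R by rewrite ltr0n.
have [xi xiP] := perturbed_cos_roots k_gt0 Mrho (@continuous_homogenization R k D) fM.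
have sin_xi (i j : 'I_k) : (i < j)%N -> 0 < sin (xi j - xi i).
  move=> ij; have [_ /andP[li ui]] := xiP i; have [_ /andP[lj uj]] := xiP j.
  (* The outer nodes of the two intervals are (j + 1 - i) pi / k apart, which is at most pi because
     j < k. *)
  apply: sin_gt0_pi; apply/andP; split.
    rewrite subr_gt0 (lt_trans ui) // (le_lt_trans _ lj) //.
    by rewrite ler_pM2r ?invr_gt0 // lerD2r ler_pM2r ?pi_gt0 // ler_nat.
  rewrite (lt_le_trans (ltrB uj li)) // -mulrBl ler_pdivrMr //.
  rewrite opprB addrA subrK -mulrBl mulrC ler_pM2l ?pi_gt0 //.
  by rewrite -natrB ?ler_nat ?leqW ?(ltnW ij) // (leq_trans (leq_subr _ _)).
have {sin_xi} sin_xi (i j : 'I_k) : i != j -> sin (xi j - xi i) != 0.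
  rewrite neq_ltn => /orP[] /sin_xi; first exact: lt0r_neq0.
  by rewrite -opprB sinN oppr_gt0 => /ltr0_neq0.
pose fin := [seq j <- enum 'I_k | cos (xi j) != 0].
pose rs := [seq tan (xi j) | j <- fin].
have uniq_rs : uniq rs.
  rewrite map_inj_in_uniq ?(filter_uniq _ (enum_uniq _)) // => i j.
  rewrite !mem_filter => /andP[ci _] /andP[cj _] tan_eq.
  apply/eqP/negPn/negP => /sin_xi /negP; apply.
  have sinE (l : 'I_k) : cos (xi l) != 0 -> sin (xi l) = tan (xi l) * cos (xi l).
    by move=> cl; rewrite /tan divfK.
  by rewrite sinB !sinE // tan_eq; apply/eqP; ring.
have root_rs : all (root D) rs.
  apply/allP => _ /mapP[j + ->]; rewrite mem_filter => /andP[cj _].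
  have [/eqP + _] := xiP j; rewrite homogenization_tan // mulf_eq0.
  by rewrite expf_eq0 (negPf cj) andbF orbF.
have D_neq0 : D != 0.
  (* At this angle the cosine is 1, and D = 0 would give rho <= M. *)
  have := fM (- psi / k%:R); rewrite [k%:R * _]mulrC divfK ?gt_eqF // addNr cos0 mulr1.
  apply: contraTneq => ->.
  rewrite /homogenization big1 => [|i _]; last by rewrite coef0 mul0r.
  by rewrite sub0r normrN -ltNge (lt_le_trans Mrho) // ler_norm.
have size_rs : size rs = (k - count (fun j => cos (xi j) == 0%R) (enum 'I_k))%N.
  rewrite size_map size_filter.
  have := count_predC (fun j => cos (xi j) == 0) (enum 'I_k).
  rewrite size_enum_ord.
  by move/(congr1 (subn^~ (count (fun j => cos (xi j) == 0) (enum 'I_k)))); rewrite addKn.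
(* Two zeros at infinity would differ by an angle whose sine is 0. *)
have count_le1 : (count (fun j => cos (xi j) == 0%R) (enum 'I_k) <= 1)%N.
  rewrite -size_filter leqNgt; apply/negP.
  case E : [seq _ <- _ | _] => [|i [|j s]] // _.
  have := filter_uniq (fun j => cos (xi j) == 0) (enum_uniq 'I_k).
  have : all (fun j => cos (xi j) == 0) [:: i, j & s] by rewrite -E filter_all.
  rewrite E /= => /and3P[/eqP ci /eqP cj _] /andP[]; rewrite inE negb_or => /andP[ij _] _.
  by have := sin_xi _ _ ij; rewrite sinB ci cj mulr0 mul0r subr0 eqxx.
have szD' : (size D <= (size rs).+1)%N.
  (* A zero at infinity kills the coefficient of X^k, which makes up for the missing finite root. *)
  rewrite size_rs; case E : (count _ _) count_le1 => [|[|]] // _; first by rewrite subn0.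
  rewrite subn1 prednK //.
  have /hasP[j _ /eqP cj] : has (fun j => cos (xi j) == 0%R) (enum 'I_k).
    by rewrite has_count E.
  have [/eqP + _] := xiP j; rewrite homogenization_infty // mulf_eq0.
  have := cos2Dsin2 (xi j); rewrite cj expr0n add0r => s2.
  have -> : (sin (xi j) ^+ k == 0) = false.
    apply/negbTE/expf_neq0; apply: contra_eq_neq s2 => ->.
    by rewrite expr0n eq_sym oner_eq0.
  rewrite orbF => /eqP Dk; apply/leq_sizeP => i.
  by rewrite leq_eqVlt => /orP[/eqP <-//|ki]; rewrite nth_default // (leq_trans szD).
have szDE : size D = (size rs).+1.
  by apply/eqP; rewrite eqn_leq szD' max_poly_roots.
exists rs; split => //; last first.
- by apply: all_roots_prod_XsubC => //; rewrite uniq_rootsE.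
- by rewrite lead_coef_eq0.
by rewrite size_rs subn_gt0 (leq_ltn_trans count_le1).
Qed.

(** * The second derivative bound, an instance of Banach's inequality *)

(** The coefficient of X^k is either zero or leading, and a negative leading coefficient would make
    P negative for large t. *)
Lemma coef_ge0_of_horner_ge0 (R : rcfType) (P : {poly R}) (k : nat) :
  (size P <= k.+1)%N -> (forall t, 0 <= P.[t]) -> 0 <= P`_k.
Proof.
move=> szP P0; have [/ltnSE szP'|szP'] := ltnP (size P) k.+1.
  by rewrite nth_default.
have szE : size P = k.+1 by apply/eqP; rewrite eqn_leq szP.
rewrite leNgt; apply/negP => Pk.
have [|t tP] := @poly_pinfty_gt_lc _ (- P).
  by rewrite lead_coefN lead_coefE szE oppr_gt0.
have := tP t (lexx _); rewrite hornerN lead_coefN lerN2 lead_coefE szE => Pt.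
by have := P0 t; rewrite leNgt (le_lt_trans Pt).
Qed.

(** Where cos a <> 0, the identity cos^2 a (1 + tan^2 a) = 1 converts the hypothesis. Where cos a =
    0, the value is the coefficient of X^(2d), compared with that of M (1 + X^2)^d, which is M. *)
Lemma homogenization_bound (R : realType) (d : nat) (F : {poly R}) (M : R) :
  (size F <= (2 * d).+1)%N ->
  (forall t, `|F.[t]| <= M * (1 + t ^+ 2) ^+ d) ->
  forall a, `|homogenization (2 * d) F a| <= M.
Proof.
move=> szF FM a.
have [ca|ca] := eqVneq (cos a) 0; last first.
  rewrite homogenization_tan // normrM [`|cos a ^+ _|]normrX exprM.
  rewrite real_normK ?num_real // (le_trans (ler_wpM2r _ (FM _))) ?(exprn_ge0 _ (sqr_ge0 _)) //.
  have -> : 1 + tan a ^+ 2 = (cos a ^+ 2)^-1.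
    have := cos2Dsin2 a; rewrite /tan expr_div_n => cs.
    have c2 : cos a ^+ 2 != 0 by rewrite expf_neq0.
    by rewrite -[X in X + _](divff c2) -mulrDl cs mul1r.
  by rewrite -mulrA -exprMn mulVf ?expf_neq0 // expr1n mulr1.
have sin1 : `|sin a ^+ (2 * d)| = 1.
  have := cos2Dsin2 a; rewrite ca expr0n add0r => s2.
  by rewrite exprM s2 expr1n normr1.
rewrite homogenization_infty // normrM sin1 mulr1.
pose N : {poly R} := (1 + 'X^2) ^+ d.
have NE t : N.[t] = (1 + t ^+ 2) ^+ d by rewrite !hornerE.
have monicX2 : (1 + 'X^2 : {poly R}) \is monic.
  by rewrite monicE lead_coefDr ?size_polyXn ?size_poly1 // lead_coefXn.
have szN : size N = (2 * d).+1.
  have := size_exp (1 + 'X^2 : {poly R}) d; rewrite addrC size_polyDl ?size_polyXn ?size_poly1 // addrC.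
  by move=> <-; rewrite prednK // size_poly_gt0 monic_neq0 // monic_exp.
have Nk : N`_(2 * d) = 1.
  have := monic_exp d monicX2; rewrite monicE lead_coefE -/N szN => /eqP //.
have coefG (G : {poly R}) : (size G <= (2 * d).+1)%N ->
    (forall t, G.[t] <= M * (1 + t ^+ 2) ^+ d) -> G`_(2 * d) <= M.
  move=> szG GM; have := @coef_ge0_of_horner_ge0 _ (M *: N - G) (2 * d).
  rewrite coefB coefZ Nk mulr1 subr_ge0; apply.
    rewrite (leq_trans (size_polyD _ _)) // size_polyN geq_max szG andbT.
    by rewrite (leq_trans (size_scale_leq _ _)) // szN.
  by move=> t; rewrite hornerD hornerN hornerZ NE subr_ge0.
rewrite ler_norml lerNl -coefN !coefG ?size_polyN // => t.
  by rewrite (le_trans _ (FM t)) // ler_norm.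
by rewrite hornerN (le_trans _ (FM t)) // -normrN ler_norm.
Qed.

(* Sharp: equality holds for the real part of (1 + i t)^(2d) at t = 0. *)
Lemma deriv2_bound (R : realType) (d : nat) (F : {poly R}) (M : R) :
  (0 < d)%N -> (size F <= (2 * d).+1)%N ->
  (forall t, `|F.[t]| <= M * (1 + t ^+ 2) ^+ d) ->
  forall t, `|F^`()^`().[t]| <= (2 * d * (2 * d).-1)%:R * M * (1 + t ^+ 2) ^+ d.-1.
Proof.
case: d => // d _; set k := (2 * d.+1)%N => szF FM t; rewrite leNgt /=; apply/negP => Ft.
have kE : k = (2 * d).+2 by rewrite /k mulnS.
have M_ge0 : 0 <= M by have := FM 0; rewrite expr0n addr0 expr1n mulr1; apply: le_trans.
pose K : R := (k * k.-1)%:R.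
have K_gt0 : 0 < K by rewrite ltr0n kE.
pose W := (1 + t ^+ 2) ^+ d.
have W_gt0 : 0 < W by rewrite exprn_gt0 // ltr_pwDl // sqr_ge0.
(* Here [d] is one less than in the statement, so c + i s = (1 + i t)^(k-2), of modulus W. *)
pose c := (harm R (2 * d)).1.[t]; pose s := (harm R (2 * d)).2.[t].
have cs : c ^+ 2 + s ^+ 2 = W ^+ 2 by rewrite sqr_harm mulnC exprM.
(* With z = x + i y, the number al + i be is the value required of z (1 + i t)^(k-2): D''(t) = - K
   al - F''(t) and D'(t) = - k (be + t al) - F'(t) must both vanish. Dividing by c + i s gives z. *)
pose al := - F^`()^`().[t] / K.
pose be := - F^`().[t] / k%:R - t * al.
pose x := (al * c + be * s) / W ^+ 2; pose y := (be * c - al * s) / W ^+ 2.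
have W2 : W ^+ 2 != 0 by rewrite expf_neq0 ?gt_eqF.
have xc : x * c - y * s = al.
  have -> : x * c - y * s = al * ((c ^+ 2 + s ^+ 2) / W ^+ 2) by rewrite /x /y; ring.
  by rewrite cs divff // mulr1.
have xs : x * s + y * c = be.
  have -> : x * s + y * c = be * ((c ^+ 2 + s ^+ 2) / W ^+ 2) by rewrite /x /y; ring.
  by rewrite cs divff // mulr1.
have [psi [xE yE]] := polar_coordinates x y.
set rho := Num.sqrt _ in xE yE.
(* Indeed rho W = |al + i be| >= |al| = |F''(t)| / K > M W. *)
have Mrho : M < rho.
  rewrite -ltr_sqr ?nnegrE ?sqrtr_ge0 // sqr_sqrtr ?addr_ge0 ?sqr_ge0 //.
  have -> : x ^+ 2 + y ^+ 2 = (al ^+ 2 + be ^+ 2) / W ^+ 2.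
    transitivity ((al ^+ 2 + be ^+ 2) / W ^+ 2 * ((c ^+ 2 + s ^+ 2) / W ^+ 2)).
      by rewrite /x /y; ring.
    by rewrite cs divff // mulr1.
  rewrite ltr_pdivlMr ?exprn_gt0 // ltr_wpDr ?sqr_ge0 // -exprMn.
  rewrite -[al ^+ 2]real_normK ?num_real // ltr_sqr ?nnegrE ?mulr_ge0 ?(ltW W_gt0) //.
  by rewrite normrM normrN normfV (gtr0_norm K_gt0) ltr_pdivlMr // mulrC mulrA.
pose D := x *: (harm R k).1 - y *: (harm R k).2 - F.
have [szc szs] := size_harm R k.
have szD : (size D <= k.+1)%N.
  rewrite !(leq_trans (size_polyD _ _)) // size_polyN geq_max szF andbT.
  rewrite !(leq_trans (size_polyD _ _)) // size_polyN geq_max.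
  by rewrite !(leq_trans (size_scale_leq _ _)).
have Dcos a : `|homogenization k D a - rho * cos (k%:R * a + psi)| <= M.
  (* The part Re(z (1 + i X)^k) homogenizes to rho cos(k a + psi) exactly, so the error comes from F
     alone. *)
  have [hc hs] := homogenization_harm k a.
  rewrite !homogenizationB !homogenizationZ hc hs.
  have -> : x * cos (k%:R * a) - y * sin (k%:R * a) = rho * cos (k%:R * a + psi).
    by rewrite cosD {1}xE {1}yE; ring.
  by rewrite addrAC subrr sub0r normrN homogenization_bound.
have k_gt1 : (1 < k)%N by rewrite kE.
have [rs [rs_gt0 uniq_rs lcD DE]] := split_of_perturbed_cos k_gt1 szD Mrho Dcos.
have [h1c h1s] := deriv_harm R (2 * d).+1.
have [h2c h2s] := deriv_harm R (2 * d).
have harmSc : (harm R (2 * d).+1).1.[t] = c - s * t by rewrite /= !hornerE.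
have harmSs : (harm R (2 * d).+1).2.[t] = s + c * t by rewrite /= !hornerE.
have k_neq0 : k%:R != 0 :> R by rewrite gt_eqF ?ltr0n // ltnW.
have dc : (harm R k).1^`().[t] = - (k%:R * (s + c * t)).
  by rewrite kE h1c hornerN hornerMn harmSs mulr_natl.
have ds : (harm R k).2^`().[t] = k%:R * (c - s * t).
  by rewrite kE h1s hornerMn harmSc mulr_natl.
have d2c : (harm R k).1^`()^`().[t] = - (K * c).
  by rewrite /K kE h1c derivN derivMn h2s hornerN !hornerMn -mulrnA mulr_natl [in LHS](mulnC _ (2 * d).+2).
have d2s : (harm R k).2^`()^`().[t] = - (K * s).
  rewrite /K kE h1s derivMn h2c hornerMn hornerN hornerMn mulNrn -mulrnA.
  by rewrite mulr_natl [in LHS](mulnC _ (2 * d).+2).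
have D1 : D^`().[t] = 0.
  rewrite /D !derivB !derivZ !hornerD !hornerN !hornerZ dc ds.
  transitivity (- (k%:R * (x * s + y * c + t * (x * c - y * s))) - F^`().[t]).
    by ring.
  by rewrite xc xs /be; field.
have D2 : D^`()^`().[t] = 0.
  rewrite /D !derivB !derivZ !hornerD !hornerN !hornerZ d2c d2s.
  transitivity (- (K * (x * c - y * s)) - F^`()^`().[t]); first by ring.
  by rewrite xc /al mulrCA divff ?gt_eqF // mulr1 opprK subrr.
have := prod_XsubC_laguerre t rs_gt0 uniq_rs => /=.
set P := \prod_(r <- rs) _ in DE *.
have -> : P^`().[t] = 0.
  by apply: (mulfI lcD); rewrite mulr0 -D1 DE derivZ hornerZ -DE.
have -> : P^`()^`().[t] = 0.
  by apply: (mulfI lcD); rewrite mulr0 -D2 DE !derivZ hornerZ -DE.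
by rewrite mulr0 subr0 expr0n ltxx.
Qed.

(** * Convexity in one variable *)

(** Since P' is nondecreasing, the graph lies above its tangent at m = l s + (1 - l) r. In the
    weighted sum of the tangent inequalities at s and r the slope terms cancel. *)
Lemma poly_convex (R : rcfType) (P : {poly R}) :
  (forall t, 0 <= P^`()^`().[t]) ->
  forall l s r, 0 <= l <= 1 ->
    P.[l * s + (1 - l) * r] <= l * P.[s] + (1 - l) * P.[r].
Proof.
move=> P2 l s r /andP[l0 l1].
have P1 (x y : R) : x < y -> P^`().[x] <= P^`().[y].
  move=> xy; have [z _ zE] := poly_mvt P^`() xy.
  by rewrite -subr_ge0 zE mulr_ge0 // subr_ge0 ltW.
have tangent m t : P.[m] + P^`().[m] * (t - m) <= P.[t].
  have [mt|tm|->] := ltgtP m t; last by rewrite subrr mulr0 addr0.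
    have [z] := poly_mvt P mt; rewrite in_itv => /andP[mz _] zE.
    by rewrite addrC -lerBrDr zE ler_wpM2r ?subr_ge0 ?(ltW mt) // P1.
  have [z] := poly_mvt P tm; rewrite in_itv => /andP[_ zm] zE.
  rewrite addrC -lerBrDr -opprB mulrN lerNl opprB zE.
  by rewrite ler_wpM2r ?subr_ge0 ?(ltW tm) // P1.
set m := l * s + (1 - l) * r.
have l1' : 0 <= 1 - l by rewrite subr_ge0.
rewrite [leLHS](_ : _ = l * (P.[m] + P^`().[m] * (s - m))
    + (1 - l) * (P.[m] + P^`().[m] * (r - m))); last by rewrite /m; ring.
by rewrite lerD // ler_wpM2l.
Qed.

(** The left side is one of the two terms of the second derivative; the other is a nonnegative
    multiple of t^2 times a power of 1 + t^2. *)
Lemma deriv2_pow_1DX2 (R : realDomainType) (d : nat) (t : R) :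
  (2 * d)%:R * (1 + t ^+ 2) ^+ d.-1 <= (((1 + 'X^2) ^+ d)^`()^`()).[t].
Proof.
have dB : (1 + 'X^2 : {poly R})^`() = 'X *+ 2.
  by rewrite derivD -polyC1 derivC add0r derivXn.
rewrite deriv_exp dB derivMn derivM derivMn derivX deriv_exp dB.
rewrite hornerMn hornerD !hornerM !hornerMn hornerM hornerMn !horner_exp !hornerE.
set B := 1 + t ^+ 2; have B0 : 0 <= B by rewrite addr_ge0 ?sqr_ge0.
rewrite mulnC natrM -mulrA -[leRHS]mulr_natl ler_wpM2l //.
by rewrite lerDl mulrnAr mulrn_wge0 // mulrA mulr_ge0 ?exprn_ge0 // -expr2 sqr_ge0.
Qed.

(** * Forms, the Euclidean norm and lines *)

Section PolynomialFunctions.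
Variables (R : realType) (n : nat).
Implicit Types (x u : 'rV[R]_n) (p : {mpoly R[n]}).

Lemma polyfunE p x :
  polyfun p x = \sum_(m <- msupp p) p@_m * \prod_i x ord0 i ^+ m i.
Proof. by []. Qed.

Lemma polyfunB_scale p q c x :
  polyfun (p - c *: q) x = polyfun p x - c * polyfun q x.
Proof. by rewrite /polyfun mevalB mevalZ. Qed.

Lemma polyfun_homogZ k p c x :
  p \is k.-homog -> polyfun p (c *: x) = c ^+ k * polyfun p x.
Proof.
move=> /dhomogP hp; rewrite !polyfunE mulr_sumr big_seq [RHS]big_seq.
apply: eq_bigr => m /hp mk; rewrite mulrCA; congr (_ * _).
rewrite -[k]mk /= mdegE expr_sum -big_split /=.
by apply: eq_bigr => i _; rewrite mxE exprMn.
Qed.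

Lemma polyfun_line k p x u :
  p \is k.-homog ->
  exists2 F : {poly R}, (size F <= k.+1)%N &
    forall t, F.[t] = polyfun p (x + t *: u).
Proof.
move=> /dhomogP hp.
pose L i : {poly R} := (x ord0 i)%:P + u ord0 i *: 'X.
exists (\sum_(m <- msupp p) p@_m *: \prod_i L i ^+ m i); last first.
  move=> t; rewrite polyfunE horner_sum; apply: eq_bigr => m _.
  rewrite hornerZ horner_prod; congr (_ * _); apply: eq_bigr => i _.
  by rewrite horner_exp !hornerE !mxE [u _ _ * _]mulrC.
have szL i : (size (L i) <= 2)%N.
  rewrite (leq_trans (size_polyD _ _)) // geq_max (leq_trans (size_polyC_leq1 _)) //.
  by rewrite (leq_trans (size_scale_leq _ _)) // size_polyX.
rewrite big_seq; apply: (big_ind (fun P : {poly R} => (size P <= k.+1)%N)) => [|P Q szP szQ|m /hp mk].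
- by rewrite size_poly0.
- by rewrite (leq_trans (size_polyD _ _)) // geq_max szP.
rewrite (leq_trans (size_scale_leq _ _)) // -[k]mk /= mdegE.
apply: (big_rec2 (fun (P : {poly R}) s => (size P <= s.+1)%N)) => [|i P s _ szP].
  by rewrite size_poly1.
rewrite (leq_trans (size_polyMleq _ _)) //.
have szLm : (size (L i ^+ m i)%R <= (m i).+1)%N.
  rewrite (leq_trans (size_poly_exp_leq _ _)) // ltnS -{2}[m i]mul1n leq_mul2r.
  by rewrite -subn1 leq_subLR szL orbT.
by rewrite -subn1 leq_subLR (leq_trans (leq_add szLm szP)) // addSn addnS.
Qed.

Lemma enorm_sqr x : enorm x ^+ 2 = \sum_i x ord0 i ^+ 2.
Proof. by rewrite sqr_sqrtr // sumr_ge0 // => i _; exact: sqr_ge0. Qed.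

Lemma enorm_ge0 x : 0 <= enorm x. Proof. exact: sqrtr_ge0. Qed.

Lemma enormZ c x : enorm (c *: x) = `|c| * enorm x.
Proof.
rewrite /enorm -sqrtr_sqr -sqrtrM ?sqr_ge0 // mulr_sumr; congr Num.sqrt.
by apply: eq_bigr => i _; rewrite mxE exprMn.
Qed.

Lemma enorm_eq0 x : (enorm x == 0) = (x == 0).
Proof.
apply/idP/eqP => [|->]; last by rewrite -(scale0r 0) enormZ normr0 mul0r.
rewrite -sqrf_eq0 enorm_sqr psumr_eq0 => [/allP x0|i _]; last exact: sqr_ge0.
apply/rowP => i; rewrite !mxE; apply/eqP; rewrite -sqrf_eq0.
exact: x0 (mem_index_enum i).
Qed.

Lemma enorm_normalize x : x != 0 -> enorm ((enorm x)^-1 *: x) = 1.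
Proof.
by rewrite -enorm_eq0 => x0; rewrite enormZ normfV ger0_norm ?enorm_ge0 // mulVf.
Qed.

(** This crude bound, from coordinates of modulus at most 1, makes [inf] and [sup] over the sphere
    genuine bounds. *)
Lemma polyfun_bounded p x :
  enorm x = 1 -> `|polyfun p x| <= \sum_(m <- msupp p) `|p@_m|.
Proof.
move=> x1; rewrite polyfunE (le_trans (ler_norm_sum _ _ _)) //.
apply: ler_sum => m _; rewrite normrM ler_piMr // normr_prod.
apply: prodr_ile1 => i _; rewrite normr_ge0 normrX exprn_ile1 //.
rewrite -(expr_le1 (n := 2)) // real_normK ?num_real //.
rewrite -[leRHS](expr1n _ 2) -x1 enorm_sqr (bigD1 i) //= lerDl.
by apply: sumr_ge0 => j _; exact: sqr_ge0.
Qed.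

Lemma pmin_le p x : enorm x = 1 -> pmin p <= polyfun p x.
Proof.
move=> x1; apply: ge_inf; last by exists x.
exists (- \sum_(m <- msupp p) `|p@_m|) => _ [y y1 <-].
by have := polyfun_bounded p y1; rewrite ler_norml => /andP[].
Qed.

Lemma pmax_ge p x : enorm x = 1 -> polyfun p x <= pmax p.
Proof.
move=> x1; apply: ub_le_sup; last by exists x.
exists (\sum_(m <- msupp p) `|p@_m|) => _ [y y1 <-].
by have := polyfun_bounded p y1; rewrite ler_norml => /andP[].
Qed.

Lemma form_bounds d p x :
  (0 < d)%N -> p \is (2 * d).-homog ->
  pmin p * enorm x ^+ (2 * d) <= polyfun p x <= pmax p * enorm x ^+ (2 * d).
Proof.
move=> d0 hp; have [->|x0] := eqVneq x 0.
  have -> : polyfun p 0 = 0.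
    by rewrite -(scale0r 0) (polyfun_homogZ _ _ hp) expr0n muln_eq0 (gtn_eqF d0) mul0r.
  have /eqP -> : enorm (0 : 'rV[R]_n) == 0 by rewrite enorm_eq0.
  by rewrite expr0n muln_eq0 (gtn_eqF d0) !mulr0 lexx.
have x1 := enorm_normalize x0.
have -> : polyfun p x = polyfun p ((enorm x)^-1 *: x) * enorm x ^+ (2 * d).
  by rewrite mulrC -(polyfun_homogZ _ _ hp) scalerA divff ?enorm_eq0 // scale1r.
by rewrite !ler_wpM2r ?exprn_ge0 ?enorm_ge0 ?pmin_le ?pmax_ge.
Qed.

Lemma enorm_line x u t :
  enorm x = 1 -> enorm u = 1 -> \sum_i x ord0 i * u ord0 i = 0 ->
  enorm (x + t *: u) ^+ 2 = 1 + t ^+ 2.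
Proof.
move=> x1 u1 xu.
have -> : enorm (x + t *: u) ^+ 2 = enorm x ^+ 2
    + t ^+ 2 * enorm u ^+ 2 + 2 * t * \sum_i x ord0 i * u ord0 i.
  rewrite !enorm_sqr !mulr_sumr -!big_split; apply: eq_bigr => i _ /=.
  by rewrite !mxE; ring.
by rewrite x1 u1 xu !expr1n mulr0 addr0 mulr1.
Qed.

(* The frame is based at the foot of the perpendicular from the origin to the
   line through a and b. *)
Lemma line_frame (a b : 'rV[R]_n) :
  (exists v s r, a = s *: v /\ b = r *: v) \/
  (exists x u c s r, [/\ enorm x = 1, enorm u = 1, \sum_i x ord0 i * u ord0 i = 0,
     a = c *: (x + s *: u) & b = c *: (x + r *: u)]).
Proof.
have [<-|ab] := eqVneq a b; first by left; exists a, 1, 1; rewrite scale1r.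
pose w := b - a; have w0 : w != 0 by rewrite subr_eq0 eq_sym.
(* [s *: w] is the projection of a onto the direction w, so [a - s *: w] is the foot of the
   perpendicular. *)
pose s := (\sum_i a ord0 i * w ord0 i) / enorm w ^+ 2.
have [y0|y0] := eqVneq (a - s *: w) 0.
  left; exists w, s, (s + 1); move/eqP: y0; rewrite subr_eq0 => /eqP aE; split=> //.
  by rewrite scalerDl scale1r -aE /w addrC subrK.
set y := a - s *: w in y0; right.
have ey0 : enorm y != 0 by rewrite enorm_eq0.
have ew0 : enorm w != 0 by rewrite enorm_eq0.
exists ((enorm y)^-1 *: y), ((enorm w)^-1 *: w), (enorm y).
exists (enorm w * s / enorm y), (enorm w * (s + 1) / enorm y).
split; rewrite ?enorm_normalize //.
- transitivity ((enorm y * enorm w)^-1 * \sum_i y ord0 i * w ord0 i).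
    by rewrite mulr_sumr; apply: eq_bigr => i _; rewrite !mxE invfM; ring.
  have -> : \sum_i y ord0 i * w ord0 i
      = \sum_i a ord0 i * w ord0 i - s * enorm w ^+ 2.
    rewrite enorm_sqr mulr_sumr -sumrB; apply: eq_bigr => i _.
    by rewrite !mxE; ring.
  by rewrite divfK ?expf_neq0 // subrr mulr0.
- rewrite scalerDr !scalerA divff // scale1r.
  have -> : enorm y * (enorm w * s / enorm y) / enorm w = s by field; rewrite ew0.
  by rewrite subrK.
rewrite scalerDr !scalerA divff // scale1r.
have -> : enorm y * (enorm w * (s + 1) / enorm y) / enorm w = s + 1.
  by field; rewrite ew0.
by rewrite scalerDl scale1r addrA subrK addrC subrK.
Qed.

End PolynomialFunctions.

(** * Convexity of the shifted form and the theorem *)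

Lemma is_convexP (R : realType) (n : nat) (p : {mpoly R[n]}) :
  (forall (l : R) (x y : 'rV[R]_n), 0 <= l <= 1 ->
     polyfun p (l *: x + (1 - l) *: y)
       <= l * polyfun p x + (1 - l) * polyfun p y) ->
  is_convex p.
Proof.
move=> h l x y _ _; apply: h.
by rewrite ge0 le1.
Qed.

(** Convexity is checked on lines. Through the origin, the form is a nonnegative multiple of t^(2d).
    On any other line, in an orthonormal frame and up to scaling, it is F + c (1 + t^2)^d with c =
    (2d-1) M; the bound 2d(2d-1) M (1 + t^2)^(d-1) on |F''| equals c times the lower bound of
    [deriv2_pow_1DX2]. *)
Lemma convex_add_norm_form (R : realType) (n d : nat) (T : {mpoly R[n]}) (M : R) :
  (0 < d)%N -> T \is (2 * d).-homog ->
  (forall x, `|polyfun T x| <= M * enorm x ^+ (2 * d)) ->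
  is_convex (T - (- ((2 * d).-1%:R * M)) *: norm_form R n d).
Proof.
move=> d0 hT TM; set c := (2 * d).-1%:R * M; set q := T - _.
have qE x : polyfun q x = polyfun T x + c * enorm x ^+ (2 * d).
  by rewrite polyfunB_scale mulNr opprK enorm_norm_form.
have qZ a x : polyfun q (a *: x) = a ^+ (2 * d) * polyfun q x.
  rewrite !qE (polyfun_homogZ _ _ hT) enormZ exprMn mulrDr mulrCA; congr (_ + _ * (_ * _)).
  by rewrite !exprM real_normK ?num_real.
have qM x : 0 <= M -> 0 <= polyfun q x.
  move=> M0; rewrite qE.
  have := TM x; rewrite ler_norml => /andP[+ _]; rewrite -mulNr -lerBlDr sub0r.
  apply: le_trans; rewrite -mulNr ler_wpM2r ?exprn_ge0 ?enorm_ge0 // lerN2.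
  (* Since d >= 1, the factor 2d - 1 is at least 1, hence c >= M. *)
  by rewrite /c ler_peMl // ler1n; case: (d) d0 => // d'; rewrite mulnS.
apply: is_convexP => l a b l01.
have [[v [s [r [-> ->]]]]|[x [u [a0 [s [r [x1 u1 xu -> ->]]]]]]] := line_frame a b.
  have [v0|v0] := eqVneq v 0.
    have q0 : polyfun q 0 = 0 by rewrite -(scale0r 0) qZ expr0n muln_eq0 (gtn_eqF d0) mul0r.
    by rewrite v0 !scaler0 addr0 q0 !mulr0 addr0.
  have qv : 0 <= polyfun q v.
    apply: qM; have := le_trans (normr_ge0 _) (TM v).
    by rewrite pmulr_lge0 // exprn_gt0 // lt_neqAle enorm_ge0 eq_sym enorm_eq0 v0.
  rewrite !scalerA -scalerDl !qZ.
  have hP := @poly_convex R (polyfun q v *: 'X^(2 * d)) _ l s r l01.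
  have {}hP := hP _; rewrite !hornerZ !hornerXn in hP.
  rewrite mulrC (le_trans (hP _)) //; last by rewrite le_eqVlt; apply/orP; left; apply/eqP; ring.
  move=> t; rewrite !derivZ derivXn derivMn derivXn hornerZ !hornerMn hornerXn.
  rewrite mulr_ge0 // !mulrn_wge0 //; case: (d) d0 => // d' _.
  by rewrite mulnS /= exprM exprn_ge0 ?sqr_ge0.
have [F szF FE] := polyfun_line x u hT.
pose Q := F + c *: (1 + 'X^2) ^+ d.
have QE t : Q.[t] = polyfun q (x + t *: u).
  by rewrite qE exprM enorm_line // hornerD hornerZ FE !hornerE.
have FM t : `|F.[t]| <= M * (1 + t ^+ 2) ^+ d.
  by rewrite FE (le_trans (TM _)) // exprM enorm_line.
have M0 : 0 <= M.
  have := le_trans (normr_ge0 _) (FM 0); rewrite expr0n addr0 expr1n mulr1 //.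
have Q2 t : 0 <= Q^`()^`().[t].
  rewrite !derivD !derivZ hornerD hornerZ.
  have := deriv2_bound d0 szF FM t; rewrite ler_norml => /andP[F2 _].
  have c0 : 0 <= c by rewrite mulr_ge0.
  have N2 := ler_wpM2l c0 (deriv2_pow_1DX2 d t).
  have E : (2 * d * (2 * d).-1)%:R * M * (1 + t ^+ 2) ^+ d.-1
      = c * ((2 * d)%:R * (1 + t ^+ 2) ^+ d.-1) by rewrite /c natrM; ring.
  by rewrite E in F2; lra.
have -> : l *: (a0 *: (x + s *: u)) + (1 - l) *: (a0 *: (x + r *: u))
    = a0 *: (x + (l * s + (1 - l) * r) *: u).
  apply/rowP => i; rewrite !mxE; ring.
rewrite !qZ -!QE.
have -> : l * (a0 ^+ (2 * d) * Q.[s]) + (1 - l) * (a0 ^+ (2 * d) * Q.[r])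
    = a0 ^+ (2 * d) * (l * Q.[s] + (1 - l) * Q.[r]) by ring.
rewrite ler_wpM2l ?poly_convex //.
by rewrite exprM exprn_ge0 // sqr_ge0.
Qed.

Theorem proposition1p1 (R : realType) (n d : nat) (p : {mpoly R[n]}) :
  (1 <= d)%N ->
  p \is (2 * d).-homog ->
  pmin p < pmax p ->
  d%:R < gap d p ->
  let q := p - (d%:R * pmin p - (d%:R - 1) * pmax p) *: norm_form R n d in
  is_convex q /\ ~ is_sos q.
Proof.
move=> d0 hp ab gap_gt q; set a := pmin p in ab gap_gt q *; set b := pmax p in ab gap_gt q *.
set c := d%:R * a - _ in q *; split.
  (* Centring p at the midpoint of its range gives the bound M on the sphere, and d a - (d-1) b =
     mid - (2d-1) M. *)
  pose mid := (a + b) / 2; pose M := (b - a) / 2.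
  have hN : norm_form R n d \is (2 * d).-homog.
    apply: dhomogMn; apply: rpred_sum => i _.
    by apply: (@dhomogMn _ _ _ 1); rewrite dhomogX; apply/eqP/mdeg1.
  have -> : q = (p - mid *: norm_form R n d)
              - (- ((2 * d).-1%:R * M)) *: norm_form R n d.
    rewrite -addrA -opprD -scalerDl; congr (_ - _ *: _).
    by rewrite /c /mid /M -subn1 natrB ?muln_gt0 // natrM; field.
  have hT : p - mid *: norm_form R n d \is (2 * d).-homog by rewrite rpredB ?rpredZ.
  refine (convex_add_norm_form d0 hT _) => x.
  rewrite polyfunB_scale enorm_norm_form ler_norml.
  have /andP[] := form_bounds x d0 hp; rewrite -/a -/b.
  set N := enorm x ^+ _ => aN bN.
  by rewrite /mid /M; apply/andP; split; lra.
move=> q_sos.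
(* On an empty sphere [inf] and [sup] both take the default value 0, against a < b. *)
have [x x1] : exists x : 'rV[R]_n, enorm x = 1.
  apply/not_existsP => nosphere; move: ab.
  have -> : a = b.
    have S0 : unit_sphere (R:=R) (n:=n) = set0.
      by apply/seteqP; split => // x /nosphere.
    by rewrite /a /b /pmin /pmax S0 !image_set0 inf0 sup0.
  by rewrite ltxx.
have sos_le_p g : is_sos (p - g *: norm_form R n d) -> g <= polyfun p x.
  move=> [qs qsE].
  have : polyfun (p - g *: norm_form R n d) x >= 0.
    rewrite qsE /polyfun rmorph_sum sumr_ge0 // => s _.
    by rewrite rmorphXn sqr_ge0.
  by rewrite polyfunB_scale enorm_norm_form x1 expr1n mulr1 subr_ge0.
(* The value p(x) at a unit vector bounds all sums-of-squares lower bounds, so their [sup] dominates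
   each of them, in particular c. *)
have : c <= pmin_sos d p.
  by apply: ub_le_sup => //; exists (polyfun p x) => g; exact: sos_le_p.
(* The gap condition rearranges to [pmin_sos d p] < b - d (b - a) = c. *)
move: gap_gt; rewrite /gap -/a -/b ltr_pdivlMr ?subr_gt0 // /c.
lra.
Qed.
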